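(* Let $q=(q_2,q_3,q_4,q_5,q_6,q_7)^T\in\mathbb{R}^6$, and let $\Psi=(v_1,v_2,v_3,s_2,u_1,u_2,u_3,r_2)^T\in\mathbb{R}^8$ be the two-channel F-transform descriptor built from $q$ with the three-node triangular construction, i.e. $v_j=F_j^0[x]$, $u_j=F_j^0[y]$ for $j=1,2,3$, $s_2=\beta_2^1[x]$, $r_2=\beta_2^1[y]$, where $x=(q_2,q_3,q_4,q_5,q_6)$ and $y=(q_3-q_2,\,q_4-q_3,\,q_5-q_4,\,q_6-q_5,\,q_7-q_6)$. Then $$\Psi=Mq,$$ where $$M=\begin{pmatrix} \frac23 & \frac13 & 0 & 0 & 0 & 0 \\ 0 & \frac14 & \frac12 & \frac14 & 0 & 0 \\ 0 & 0 & 0 & \frac13 & \frac23 & 0 \\ 0 & -\frac12 & 0 & \frac12 & 0 & 0 \\ -\frac23 & \frac13 & \frac13 & 0 & 0 & 0 \\ 0 & -\frac14 & -\frac14 & \frac14 & \frac14 & 0 \\ 0 & 0 & 0 & -\frac13 & -\frac13 & \frac23 \\ 0 & \frac12 & -\frac12 & -\frac12 & \frac12 & 0 \end{pmatrix}.$$ Moreover, $\operatorname{rank}M=6$. Consequently, the map $q\mapsto\Psi$ is injective.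
   Context: Three-node triangular construction: on the sample points $t\in\{0,1,2,3,4\}$ take centers $c_1=0$, $c_2=2$, $c_3=4$, bandwidth $h=2$, and $A_j(t)=\max\left(0,\,1-\frac{|t-c_j|}{h}\right)$ for $j=1,2,3$. For a five-point real signal $z=(z_0,z_1,z_2,z_3,z_4)$ define the zero-degree F-transform coefficients $$F_j^0[z]=\frac{\sum_{t=0}^4 z_tA_j(t)}{\sum_{t=0}^4 A_j(t)},\qquad j=1,2,3,$$ and the centered first-degree coefficient $$\beta_2^1[z]=\frac{\sum_{t=0}^4 z_t(t-c_2)A_2(t)}{\sum_{t=0}^4 (t-c_2)^2A_2(t)}.$$ Origin of the data: for a trajectory of matrices $(P_k)$ with positive Frobenius step sizes $\delta_k=\|P_{k+1}-P_k\|_F$, one sets $q_k=\log\delta_k$ and $\rho_k=\delta_{k+1}/\delta_k$, so that $\log\rho_k=q_{k+1}-q_k$. Thus $x$ is the logarithmic step-size channel $(q_2,\dots,q_6)$ and $y$ is the logarithmic contraction-ratio channel $(\log\rho_2,\dots,\log\rho_6)$. *)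

(* Defs.v *)
From mathcomp Require Import all_boot all_order all_algebra.
From mathcomp Require Import reals.

Set Implicit Arguments.
Unset Strict Implicit.
Unset Printing Implicit Defensive.

Import Order.TTheory GRing.Theory Num.Theory.
Local Open Scope ring_scope.

Definition c1 {R : realType} : R := 0.
Definition c2 {R : realType} : R := 2.
Definition c3 {R : realType} : R := 4.
Definition bandwidth {R : realType} : R := 2.

Definition tri {R : realType} (c : R) (t : 'I_5) : R :=
  Num.max 0 (1 - `|t%:R - c| / bandwidth).

Definition F0 {R : realType} (c : R) (z : 'cV[R]_5) : R :=
  (\sum_(t < 5) z t 0 * tri c t) / (\sum_(t < 5) tri c t).

Definition beta1 {R : realType} (c : R) (z : 'cV[R]_5) : R :=
  (\sum_(t < 5) z t 0 * (t%:R - c) * tri c t) /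
  (\sum_(t < 5) (t%:R - c) ^+ 2 * tri c t).

(* Indices are shifted by 2: entry k of [q : 'cV_6] is the paper's q_(k+2).
   [widen_ord (leqnSn 5) t] and [lift ord0 t] are t and t+1 as elements of
   'I_6. *)
Definition step_channel {R : realType} (q : 'cV[R]_6) : 'cV[R]_5 :=
  \col_(t < 5) q (widen_ord (leqnSn 5) t) 0.

Definition ratio_channel {R : realType} (q : 'cV[R]_6) : 'cV[R]_5 :=
  \col_(t < 5) (q (lift ord0 t) 0 - q (widen_ord (leqnSn 5) t) 0).

Definition descriptor {R : realType} (q : 'cV[R]_6) : 'cV[R]_8 :=
  let x := step_channel q in
  let y := ratio_channel q in
  \col_(i < 8) [:: F0 c1 x; F0 c2 x; F0 c3 x; beta1 c2 x;
                   F0 c1 y; F0 c2 y; F0 c3 y; beta1 c2 y]`_i.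

Definition descriptor_mx (R : realType) : 'M[R]_(8, 6) :=
  \matrix_(i < 8, j < 6)
    (nth [::]
      [:: [:: 2/3;     1/3;     0;       0;       0;     0];
          [:: 0;       1/4;     1/2;     1/4;     0;     0];
          [:: 0;       0;       0;       1/3;     2/3;   0];
          [:: 0;       - (1/2); 0;       1/2;     0;     0];
          [:: - (2/3); 1/3;     1/3;     0;       0;     0];
          [:: 0;       - (1/4); - (1/4); 1/4;     1/4;   0];
          [:: 0;       0;       0;       - (1/3); - (1/3); 2/3];
          [:: 0;       1/2;     - (1/2); - (1/2); 1/2;   0]] i)`_j.

(* Main.v *)
Require Import Defs.
From mathcomp Require Import all_boot all_order all_algebra.
From mathcomp Require Import reals.
From mathcomp Require Import ring lra.

Import Order.TTheory GRing.Theory Num.Theory.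
Local Open Scope ring_scope.

(** The triangular weights are (1, 1/2, 0, 0, 0), (0, 1/2, 1, 1/2, 0) and
    (0, 0, 0, 1/2, 1), so each coefficient is an explicit linear form in the
    channel; substituting the two channels gives [descriptor q = M *m q] entry
    by entry.

    For the rank, six of the eight coefficients already determine [q].  Write
    q_0, ..., q_5 for the entries.  Then 2 v_2 - s_2 = q_1 + q_2 and
    3 (v_1 + u_1) = 2 q_1 + q_2, which give q_1 and q_2; next s_2 gives q_3,
    v_1 gives q_0, v_3 gives q_4, and u_3 gives q_5.  Hence [M] has trivial
    kernel ([descriptor_mx_ker0]), which yields both the full column rank and
    the injectivity of the descriptor. *)

(** At an integer center the weight is a computable rational: truncated
    subtraction on natural numbers performs the clipping at 0, and
    (t - m) + (m - t) is the distance between t and m. *)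
Lemma tri_nat (R : realType) (m : nat) (t : 'I_5) :
  tri (m%:R : R) t = (2 - ((t - m) + (m - t)))%:R / 2.
Proof.
rewrite /tri /bandwidth.
have -> : `|t%:R - m%:R| = ((t - m) + (m - t))%:R :> R.
  case: (leqP m t) => [le_mt | /ltnW le_tm].
    by rewrite -natrB // normr_nat (eqP le_mt) addn0.
  by rewrite distrC -natrB // normr_nat (eqP le_tm) add0n.
move: ((t - m) + (m - t))%N => d.
case: (leqP d 2) => [le_d2 | /ltnW le_2d].
  have d2 : d%:R <= 2 :> R by rewrite ler_nat.
  rewrite natrB // max_r; last by lra.
  by field.
have d2 : 2 <= d%:R :> R by rewrite ler_nat.
by rewrite (eqP le_2d) mul0r max_l //; lra.
Qed.

(** Indexing by natural numbers gives the different presentations of the same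
    ordinal ([widen_ord], [lift], nested [lift]s) one normal form, reached by
    computation. *)
Definition entry {R : realType} {n : nat} (z : 'cV[R]_n.+1) (k : nat) : R :=
  z (inord k) 0.

Lemma entryE {R : realType} {n : nat} (z : 'cV[R]_n.+1) (i : 'I_n.+1) :
  z i 0 = entry z i.
Proof. by rewrite /entry inord_val. Qed.

Lemma F0_c1 (R : realType) (z : 'cV[R]_5) :
  F0 c1 z = 2/3 * entry z 0 + 1/3 * entry z 1.
Proof.
(* [c1] is the ring zero, which [tri_nat] only recognizes as [0%:R]. *)
rewrite -[F0 _ _]/(F0 0%:R z) /F0 !big_ord_recl !big_ord0 !tri_nat.
rewrite !(entryE z) /= /bump /= !add1n.
(* Natural subtraction is shielded from simplification, so it is unfolded to
   evaluate the weights. *)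
by rewrite /subn /addn /=; field.
Qed.

Lemma F0_c2 (R : realType) (z : 'cV[R]_5) :
  F0 c2 z = 1/4 * entry z 1 + 1/2 * entry z 2 + 1/4 * entry z 3.
Proof.
rewrite /F0 /c2 !big_ord_recl !big_ord0 !tri_nat !(entryE z) /= /bump /=.
by rewrite !add1n /subn /addn /=; field.
Qed.

Lemma F0_c3 (R : realType) (z : 'cV[R]_5) :
  F0 c3 z = 1/3 * entry z 3 + 2/3 * entry z 4.
Proof.
rewrite /F0 /c3 !big_ord_recl !big_ord0 !tri_nat !(entryE z) /= /bump /=.
by rewrite !add1n /subn /addn /=; field.
Qed.

Lemma beta1_c2 (R : realType) (z : 'cV[R]_5) :
  beta1 c2 z = 1/2 * entry z 3 - 1/2 * entry z 1.
Proof.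
rewrite /beta1 /c2 !big_ord_recl !big_ord0 !tri_nat !(entryE z) /= /bump /=.
by rewrite !add1n /subn /addn /=; field.
Qed.

Lemma step_channelE (R : realType) (q : 'cV[R]_6) (k : nat) :
  (k < 5)%N -> entry (step_channel q) k = entry q k.
Proof. by move=> lt_k5; rewrite {1}/entry mxE (entryE q) /= inordK. Qed.

Lemma ratio_channelE (R : realType) (q : 'cV[R]_6) (k : nat) :
  (k < 5)%N ->
  entry (ratio_channel q) k = entry q k.+1 - entry q k.
Proof.
by move=> lt_k5; rewrite {1}/entry mxE !(entryE q) /= /bump add1n inordK.
Qed.

Lemma descriptor_mulmx (R : realType) (q : 'cV[R]_6) :
  descriptor q = descriptor_mx R *m q.
Proof.
apply/matrixP=> i j; rewrite (ord1 j) [LHS]mxE [RHS]mxE.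
rewrite F0_c1 F0_c2 F0_c3 beta1_c2 F0_c1 F0_c2 F0_c3 beta1_c2.
rewrite !step_channelE // !ratio_channelE //.
rewrite !big_ord_recl big_ord0 !mxE !(entryE q) /= /bump /= !add1n.
by case: i; do 8?[case=> [|] //=]; move=> *; field.
Qed.

(** Rows 0-4 and 6, that is v_1, v_2, v_3, s_2, u_1 and u_3, form an
    invertible 6 x 6 system. *)
Lemma descriptor_mx_ker0 (R : realType) (q : 'cV[R]_6) :
  descriptor_mx R *m q = 0 -> q = 0.
Proof.
move=> Mq0.
have row0 k : (descriptor_mx R *m q) (inord k) 0 = 0 by rewrite Mq0 mxE.
have := (row0 0, row0 1, row0 2, row0 3, row0 4, row0 6)%N.
rewrite !mxE !big_ord_recl !big_ord0 !mxE !inordK // !(entryE q) /=.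
rewrite /bump /= !add1n => -[[[[[v1 v2] v3] s2] u1] u3].
apply/matrixP=> i j; rewrite (ord1 j) [RHS]mxE (entryE q).
by case: i; do 6?[case=> [|] //=]; move=> *; lra.
Qed.

Theorem theorem3p2 (R : realType) :
  (forall q : 'cV[R]_6, descriptor q = descriptor_mx R *m q) /\
  \rank (descriptor_mx R) = 6%N /\
  injective (fun q : 'cV[R]_6 => descriptor q).
Proof.
split; first exact: descriptor_mulmx.
split.
  rewrite -mxrank_tr; apply/eqP/inj_row_free => v vM0.
  apply: trmx_inj; rewrite trmx0; apply: descriptor_mx_ker0.
  by apply: trmx_inj; rewrite trmx_mul trmxK trmx0.
move=> q q'; rewrite !descriptor_mulmx => eqMq.
by apply/subr0_eq/descriptor_mx_ker0; rewrite mulmxBr eqMq subrr.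
Qed.
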